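(* Fix an integer $d\ge 2$. For $N\geq 1$ let $$P(N)=\{c\in\mathbb{Q}: h(c)\le N\},\qquad P_d(N)=\{c\in\mathbb{Q}: x^d+c \text{ has a rational periodic point},\ h(c)\le N\}.$$ Then $$\lim_{N\to\infty}\frac{|P_d(N)|}{|P(N)|}=0.$$
   Context: For $c=a/b\in\mathbb{Q}$ with $\gcd(a,b)=1$, the height of $c$ is $h(c)=\max\{|a|,|b|\}$. A rational periodic point of $f(x)=x^d+c$ is $u\in\mathbb{Q}$ such that $f^n(u)=u$ for some $n\ge 1$, where $f^n$ denotes the $n$-th iterate of $f$. *)

(* Defs.v *)
From mathcomp Require Import all_boot all_order all_algebra finmap.
From mathcomp Require Import all_classical all_reals all_analysis.

Set Implicit Arguments.
Unset Strict Implicit.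
Unset Printing Implicit Defensive.

Import Order.TTheory GRing.Theory Num.Theory.
Import numFieldNormedType.Exports.

Local Open Scope classical_set_scope.
Local Open Scope ring_scope.

(* [numq c] and [denq c] are the coprime numerator and denominator of [c]
   (with [0 = 0 / 1]). *)
Definition height (c : rat) : nat := maxn `|numq c|%N `|denq c|%N.

Definition unicritical (d : nat) (c : rat) (x : rat) : rat := x ^+ d + c.

Definition rational_periodic_point (f : rat -> rat) (u : rat) : Prop :=
  exists2 n : nat, (1 <= n)%N & iter n f u = u.

Definition P (N : nat) : set rat := [set c | (height c <= N)%N].

Definition Pd (d N : nat) : set rat :=
  [set c | (exists u : rat, rational_periodic_point (unicritical d c) u) /\
           (height c <= N)%N].

(* Cardinality of a finite set; both [P N] and [Pd d N] are finite, so the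
   junk value of [fset_set] on infinite sets plays no role. *)
Definition set_size (A : set rat) : nat := #|` fset_set A |%fset.

(* Main.v *)
Require Import Defs.
From mathcomp Require Import all_boot all_order all_algebra finmap.
From mathcomp Require Import all_classical all_reals all_analysis.
From mathcomp Require Import ring lra zify.

Import Order.TTheory GRing.Theory Num.Theory.
Import numFieldNormedType.Exports.

Local Open Scope classical_set_scope.
Local Open Scope ring_scope.

(** If [x ^ d + c] has a rational periodic point, then the denominator of [c]
    is a [d]-th power; such [c] are sparse among rationals of bounded height.

    For the arithmetic claim, let [s] be the least common denominator of the
    points [x_i] of the cycle and put [m_i = s * x_i], an integer.  Multiplying
    [x_(i+1) = x_i ^ d + c] by [s ^ d] gives
    [s ^ d * c = s ^ (d - 1) * m_(i+1) - m_i ^ d], an integer independent of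
    [i].  A prime dividing both [s] and this integer would, as [d >= 2], divide
    every [m_i], so that [s] divided by this prime would still be a common
    denominator, against minimality.  Hence the fraction
    [(s ^ d * c) / s ^ d] is reduced, and [denq c = s ^ d]
    ([denq_orbit_lcm], [denq_periodic]).

    For the count, [c] in [Pd d N] is then given by a numerator in [[-N, N]]
    and an [s] with [s ^ 2 <= s ^ d <= N], so [Pd d N] has at most
    [(2 N + 1) * sqrt N] elements ([set_size_Pd_le]).  On the other hand [P N]
    has at least [N ^ 2 / 4] elements ([sq_le_set_size_P]): a non-coprime pair
    in [[1, N] ^ 2] lies in the [(N %/ g) ^ 2] pairs of multiples of some
    [g >= 2], and the sum over [g >= 2] of [1 / g ^ 2] is at most [3 / 4].
    The ratio is therefore [O(1 / sqrt N)] ([ratio_le]). *)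

(** * Denominators of parameters with a periodic point *)

Lemma denq_dvdP (x : rat) (t : nat) :
  (`|denq x| %| t)%N <-> exists m : int, t%:R * x = m%:~R.
Proof.
have dx0 : (denq x)%:~R != 0 :> rat by rewrite intr_eq0 denq_eq0.
split=> [/dvdnP[k ->]|[m tx]].
  exists (k%:Z * numq x).
  rewrite natrM -mulrA intrM; congr (_ * _).
  by rewrite numqE mulrC pmulrn absz_denq.
have tn : t%:Z * numq x = m * denq x.
  by apply: (@intr_inj rat); rewrite !intrM -tx numqE mulrA pmulrn.
rewrite -(@Gauss_dvdl _ _ `|numq x|%N) 1?coprime_sym ?coprime_num_den //.
have := congr1 absz tn; rewrite !abszM absz_nat => ->.
exact: dvdn_mull.
Qed.

(** The last hypothesis says that [s] is the least common denominator of the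
    orbit.  Clearing denominators writes [c] as [M / s ^ d] for an integer [M],
    and minimality of [s] makes this fraction reduced.  Taking the lcm over all
    points at once replaces a prime-by-prime comparison of valuations. *)
Lemma denq_orbit_lcm (d : nat) (c : rat) (x : nat -> rat) (s : nat) :
    (2 <= d)%N -> (0 < s)%N ->
    (forall i, x i.+1 = unicritical d c (x i)) ->
    (forall t, (forall i, (`|denq (x i)| %| t)%N) <-> (s %| t)%N) ->
  denq c = (s ^ d)%N.
Proof.
move=> d2 s0 xS s_lcm.
have sR0 : s%:R != 0 :> rat by rewrite pnatr_eq0 -lt0n.
have /choice[m mE] : forall i, exists m : int, s%:R * x i = m%:~R.
  by move=> i; apply/denq_dvdP; move: i; apply/s_lcm.
pose M i := s%:Z ^+ d.-1 * m i.+1 - m i ^+ d.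
have ME i : (M i)%:~R = (s ^ d)%N%:R * c.
  rewrite /M intrB intrM !rmorphXn /= -!mE xS /unicritical exprMn.
  rewrite -pmulrn mulrA -exprSr prednK ?(ltnW d2) //; ring.
have sdM : coprime `|M 0%N| (s ^ d)%N.
  apply/negPn/negP => /negP ncop.
  pose p := pdiv (gcdn `|M 0%N| (s ^ d)).
  have sd0 : (0 < s ^ d)%N by rewrite expn_gt0 s0.
  have pP : prime p.
    apply: pdiv_prime; rewrite ltn_neqAle eq_sym gcdn_gt0 sd0 orbT andbT.
    exact/negP.
  have := pdiv_dvd (gcdn `|M 0%N| (s ^ d)); rewrite -/p dvdn_gcd.
  case/andP=> pM; rewrite Euclid_dvdX // => /andP[ps _].
  (* [M] does not depend on [i], so [p] divides every [m i], not only [m 0] *)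
  have pm i : (`|p%:Z| %| `|m i|)%N.
    have -> : (`|p%:Z| %| `|m i|)%N = (p %| `|m i ^+ d|)%N.
      by rewrite abszX Euclid_dvdX // absz_nat (ltnW d2) andbT.
    have -> : m i ^+ d = s%:Z ^+ d.-1 * m i.+1 - M 0%N.
      have -> : M 0%N = M i by apply: (@intr_inj rat); rewrite !ME.
      by rewrite /M; ring.
    have: (p%:Z %| s%:Z ^+ d.-1 * m i.+1 - M 0%N)%Z.
      rewrite rpredB //.
      apply: dvdz_mulr; rewrite dvdzE abszX Euclid_dvdX //= ps /=.
      by rewrite -ltnS prednK // ltnW.
    by rewrite dvdzE.
  (* dividing [s] by [p] still clears every denominator *)
  have p0 := prime_gt0 pP.
  have spE : s = (p * (s %/ p))%N by rewrite mulnC divnK.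
  have /s_lcm : forall i, (`|denq (x i)| %| s %/ p)%N.
    move=> i; apply/denq_dvdP.
    have /dvdzP[k kE] : (p%:Z %| m i)%Z by rewrite dvdzE.
    exists k; apply: (@mulfI _ (p%:R : rat)).
      by rewrite pnatr_eq0 -lt0n.
    by rewrite mulrA -natrM -spE mE kE intrM mulrC -pmulrn.
  apply/negP; rewrite gtnNdvd //; last first.
    by rewrite ltn_Pdiv // prime_gt1.
  by rewrite divn_gt0 // dvdn_leq.
have -> : c = (M 0%N)%:~R / (Posz (s ^ d))%:~R.
  by rewrite ME -pmulrn natrX mulrC mulKf // expf_neq0.
rewrite coprimeq_den ?absz_nat // ifF //.
by apply/negbTE; rewrite -lt0n expn_gt0 s0.
Qed.

(** A cycle is a finite orbit, so the lcm of the denominators of its points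
    exists and [denq_orbit_lcm] applies to it. *)
Lemma denq_periodic (d : nat) (c u : rat) :
    (2 <= d)%N -> rational_periodic_point (unicritical d c) u ->
  exists2 s : nat, (0 < s)%N & denq c = (s ^ d)%N.
Proof.
move=> d2 [n n1 un]; set f := unicritical d c in un *.
have periodic k : iter k f u = iter (k %% n) f u.
  rewrite {1}(divn_eq k n) addnC iterD; congr (iter _ f _).
  by elim: (k %/ n)%N => // q IH; rewrite mulSn iterD IH.
pose s := (\big[lcmn/1%N]_(i < n) `|denq (iter i f u)|)%N.
have s0 : (0 < s)%N.
  apply: (big_ind (fun k => (0 < k)%N)) => // [x y x0 y0|i _].
    by rewrite lcmn_gt0 x0.
  by rewrite absz_gt0 denq_eq0.
exists s => //; apply: (@denq_orbit_lcm d c (fun i => iter i f u)) => // t.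
split=> [dvdt|st i]; first by apply/dvdn_biglcmP => i _.
apply: dvdn_trans st; rewrite periodic.
have im : (i %% n < n)%N by rewrite ltn_mod.
exact: (@biglcmn_sup _ (Ordinal im)).
Qed.

(** * Counting coprime pairs *)

Definition coprime_pairs (N : nat) : seq (nat * nat) :=
  [seq x <- [seq (a, b) | a <- index_iota 1 N.+1, b <- index_iota 1 N.+1]
     | coprime x.1 x.2].

Lemma size_coprime_pairsE N :
  size (coprime_pairs N) =
  (\sum_(1 <= a < N.+1) \sum_(1 <= b < N.+1) coprime a b)%N.
Proof.
rewrite size_filter -sum1_count big_mkcond big_allpairs.
by apply: eq_bigr => a _; apply: eq_bigr => b _ /=; case: coprime.
Qed.

Lemma count_multiples g N :
  (0 < g)%N -> (\sum_(1 <= a < N.+1) (g %| a) = N %/ g)%N.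
Proof.
move=> g0; elim: N => [|N IH]; first by rewrite big_geq // div0n.
by rewrite big_nat_recr //= IH divnS // addnC.
Qed.

(** The union bound over possible common divisors, pointwise: when the pair is
    not coprime, the term [g = gcdn a b] of the sum is [1]. *)
Lemma coprime_or_common_divisor a b N :
  (0 < a <= N)%N ->
  (1 <= coprime a b + \sum_(2 <= g < N.+1) (g %| a) * (g %| b))%N.
Proof.
case/andP=> a0 aN; have [//|ncop] := boolP (coprime a b).
rewrite add0n (big_cat_nat (n := gcdn a b)) /=; last 2 first.
- by rewrite ltn_neqAle eq_sym ncop gcdn_gt0 a0.
- by rewrite leqW // (leq_trans _ aN) // dvdn_leq // dvdn_gcdl.
rewrite [X in (_ + X)%N]big_ltn.
  by rewrite dvdn_gcdl dvdn_gcdr addnCA leq_addr.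
by rewrite ltnS (leq_trans _ aN) // dvdn_leq // dvdn_gcdl.
Qed.

Lemma sq_le_coprime_add N :
  (N ^ 2 <= size (coprime_pairs N) + \sum_(2 <= g < N.+1) (N %/ g) ^ 2)%N.
Proof.
have -> : (N ^ 2 = \sum_(1 <= a < N.+1) \sum_(1 <= b < N.+1) 1)%N.
  by rewrite !sum_nat_const_nat subn1 muln1 mulnn.
have -> : (\sum_(2 <= g < N.+1) (N %/ g) ^ 2 =
  \sum_(1 <= a < N.+1) \sum_(1 <= b < N.+1)
    \sum_(2 <= g < N.+1) (g %| a) * (g %| b))%N.
  under [RHS]eq_bigr do rewrite exchange_big /=.
  rewrite [RHS]exchange_big /= big_nat [RHS]big_nat.
  apply: eq_bigr => g /andP[g2 _]; rewrite -mulnn.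
  rewrite -{1}(count_multiples _ _ (ltnW g2)) big_distrl /=.
  apply: eq_bigr => a _; rewrite -(count_multiples _ _ (ltnW g2)).
  by rewrite big_distrr.
rewrite size_coprime_pairsE -big_split /= big_nat [leqRHS]big_nat.
apply: leq_sum => a /andP[a0 aN]; rewrite -big_split /=.
by apply: leq_sum => b _; apply: coprime_or_common_divisor; rewrite a0.
Qed.

(** Telescoping [1 / g ^ 2 <= 1 / (g - 1) - 1 / g] from [g = 3] on; the term
    [g = 2] is kept exact, since telescoping it too would only bound the whole
    sum by [1], which is useless for [size_coprime_pairs_ge]. *)
Lemma sum_inv_sq_le n :
  \sum_(2 <= g < n.+3) (g%:R ^- 2 : rat) <= 3 / 4 - n.+2%:R^-1.
Proof.
elim: n => [|n IH]; first by rewrite big_nat1.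
rewrite big_nat_recr //=; apply: (le_trans (lerD IH (lexx _))).
have n0 : 0 <= n%:R :> rat by [].
rewrite -!natr1.
have H (y : rat) : 0 < y -> (y + 1) ^- 2 <= y^-1 - (y + 1)^-1.
  move=> y0; have -> : y^-1 - (y + 1)^-1 = (y * (y + 1))^-1 by field; lra.
  rewrite lef_pV2 ?posrE; nra.
have := H (n%:R + 1 + 1); lra.
Qed.

Lemma size_coprime_pairs_ge N : (N ^ 2 <= 4 * size (coprime_pairs N))%N.
Proof.
case: N => [//|[//|n]]; set N := n.+2.
have bad : (\sum_(2 <= g < N.+1) (N %/ g) ^ 2)%:R <= 3 / 4 * N%:R ^+ 2 :> rat.
  rewrite natr_sum.
  apply: (@le_trans _ _ (\sum_(2 <= g < N.+1) N%:R ^+ 2 * (g%:R ^- 2))).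
    rewrite !big_nat; apply: ler_sum => g /andP[g2 _].
    rewrite natrX -exprVn -exprMn lerXn2r ?nnegrE //.
    rewrite ler_pdivlMr ?ltr0n ?(ltnW g2) // -natrM ler_nat.
    exact: leq_trunc_div.
  rewrite -mulr_sumr mulrC ler_wpM2r ?exprn_ge0 //.
  apply: (le_trans (sum_inv_sq_le n)).
  by rewrite gerBl invr_ge0.
have := sq_le_coprime_add N.
rewrite -(ler_nat rat) -(ler_nat rat _ (4 * _)) natrD natrX natrM.
lra.
Qed.

(** * Counting rationals of bounded height *)

Lemma set_size_le (A : set rat) (s : seq rat) :
  (forall c, A c -> c \in s) -> (set_size A <= size s)%N.
Proof.
move=> As; have finA : finite_set A by apply: sub_finite_set (finite_seq s).
apply: uniq_leq_size; first exact: fset_uniq.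
by move=> c; rewrite in_fset_set // inE => /As.
Qed.

Lemma set_size_ge (A : set rat) (s : seq rat) :
    finite_set A -> uniq s -> (forall c, c \in s -> A c) ->
  (size s <= set_size A)%N.
Proof.
move=> finA us sA; apply: uniq_leq_size => // c cs.
by rewrite in_fset_set // inE; apply: sA.
Qed.

(** The numerators [a - N] run over the integers of [[-N, N]]. *)
Definition bounded_fractions (N : nat) (dens : seq nat) : seq rat :=
  [seq (a%:Z - N%:Z)%:~R / b%:R | a <- iota 0 (N.*2.+1), b <- dens].

Lemma mem_bounded_fractions N dens c b :
    (height c <= N)%N -> denq c = b%:Z -> b \in dens ->
  c \in bounded_fractions N dens.
Proof.
rewrite geq_max => /andP[num_le _] denE bdens; apply/allpairsP.
exists (absz (numq c + N%:Z), b); split => //.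
  by rewrite mem_iota [_.1]/=; lia.
rewrite /= gez0_abs; last by lia.
by rewrite addrK -[LHS]divq_num_den denE.
Qed.

Lemma finite_P N : finite_set (P N).
Proof.
apply: sub_finite_set (finite_seq (bounded_fractions N (iota 0 N.+1))).
move=> c hc; apply: (@mem_bounded_fractions _ _ _ `|denq c|%N) => //.
  by rewrite absz_denq.
by rewrite mem_iota /= ltnS (leq_trans _ hc) // leq_maxr.
Qed.

(** Distinct coprime pairs give distinct fractions, because a reduced fraction
    determines its numerator and denominator. *)
Lemma sq_le_set_size_P N : (N ^ 2 <= 4 * set_size (P N))%N.
Proof.
apply: (leq_trans (size_coprime_pairs_ge N)); rewrite leq_pmul2l //.
pose frac (x : nat * nat) : rat := x.1%:Z%:~R / x.2%:Z%:~R.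
have fracE x : x \in coprime_pairs N ->
    [/\ (x.1 <= N)%N, (x.2 <= N)%N, numq (frac x) = x.1
      & denq (frac x) = x.2].
  rewrite mem_filter => /andP[cop /allpairsP[[a b] /= [aN bN xE]]].
  move: cop aN bN; rewrite xE /= !mem_index_iota !ltnS.
  move=> cop /andP[a0 aN] /andP[b0 bN]; split => //; rewrite /frac /=.
    by rewrite coprimeq_num // gtr0_sg ?mul1r // ltz_nat.
  by rewrite coprimeq_den // ifF // eqz_nat gtn_eqF.
rewrite -(size_map frac); apply: set_size_ge; first exact: finite_P.
  rewrite map_inj_in_uniq.
    apply/filter_uniq/allpairs_uniq; rewrite ?iota_uniq //.
    by move=> [? ?] [? ?] _ _ [-> ->].
  move=> x y /fracE[_ _ xn xd] /fracE[_ _ yn yd] xy.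
  move: xn xd; rewrite xy yn yd => -[] + [].
  by case: x y {xy yn yd} => [? ?] [? ?] /= -> ->.
move=> c /mapP[x /fracE[x1 x2 nE dE] ->].
by rewrite /P /= /height nE dE !absz_nat geq_max x1.
Qed.

Lemma set_size_Pd_le d N r : (2 <= d)%N ->
    (forall s, (s ^ 2 <= N)%N -> (s <= r)%N) ->
  (set_size (Pd d N) <= N.*2.+1 * r)%N.
Proof.
move=> d2 r_max.
pose dens := [seq (s ^ d)%N | s <- iota 1 r].
apply: (@leq_trans (size (bounded_fractions N dens))); last first.
  by rewrite size_allpairs size_map !size_iota.
apply: set_size_le => c [[u /(denq_periodic _ _ _ d2)[s s0 denE]] hc].
apply: (mem_bounded_fractions _ _ _ _ hc denE).
apply: map_f; rewrite mem_iota s0 add1n ltnS; apply: r_max.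
apply: leq_trans hc; apply: leq_trans (leq_maxr _ _).
by rewrite denE absz_nat leq_pexp2l.
Qed.

Lemma floor_sqrt N :
  exists2 r, (r ^ 2 <= N)%N & forall s, (s ^ 2 <= N)%N -> (s <= r)%N.
Proof.
have ub s : (s ^ 2 <= N)%N -> (s <= N)%N by nia.
have ex0 : exists s, (s ^ 2 <= N)%N by exists 0%N.
by have [r] := ex_maxnP ex0 ub; exists r.
Qed.

(** * The limit *)

(** [harmonic N] is [1 / (N + 1)]; the constant [24] is [4 * 3 * 2], where
    [4] comes from the lower bound for [P N], [3] from [2 N + 1 <= 3 N] and
    [2] from [sqrt N <= 2 * N / sqrt (N + 1)]. *)
Lemma ratio_le (R : realType) d N : (2 <= d)%N ->
  (set_size (Pd d N))%:R / (set_size (P N))%:R <= 24 * Num.sqrt (harmonic N : R).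
Proof.
move=> d2; have [->|N0] := posnP N.
  (* at [N = 0] no denominator is available, and the numerator vanishes *)
  have [r r2 /(set_size_Pd_le d _ _ d2)] := floor_sqrt 0.
  have -> : r = 0%N by lia.
  by rewrite muln0 leqn0 => /eqP->; rewrite mul0r mulr_ge0 ?sqrtr_ge0.
have [r r2 /(set_size_Pd_le d _ _ d2) up] := floor_sqrt N.
have := sq_le_set_size_P N.
set A := set_size _ in up *; set B := set_size _ => low.
have B0 : (0 < B)%N by nia.
have {}up : (A <= 3 * N * r)%N by rewrite (leq_trans up) // leq_mul2r; lia.
have hsq : Num.sqrt (harmonic N : R) ^+ 2 = N.+1%:R^-1.
  by rewrite sqr_sqrtr // harmonic_ge0.
have h0 : 0 <= Num.sqrt (harmonic N : R) by [].
rewrite ler_pdivrMr ?ltr0n //.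
set h := Num.sqrt _ in hsq h0 *.
have rh : r%:R <= 2 * N%:R * h.
  have rp : 0 <= 2 * N%:R * h by rewrite !mulr_ge0.
  rewrite -(@ler_pXn2r _ 2) ?nnegrE // !exprMn hsq.
  rewrite ler_pdivlMr ?ltr0n // -!natrX -!natrM ler_nat; nia.
apply: (@le_trans _ _ (3 * N * r)%N%:R); first by rewrite ler_nat.
apply: (@le_trans _ _ (3 * N%:R * (2 * N%:R * h))).
  by rewrite 2!natrM ler_wpM2l // mulr_ge0.
have : (N%:R ^+ 2 <= 4 * B%:R :> R) by rewrite -natrX -natrM ler_nat.
by nra.
Qed.

Theorem theorem4p8 (R : realType) (d : nat) (hd : (2 <= d)%N) :
  (set_size (Pd d N))%:R / (set_size (P N))%:R @[N --> \oo] --> (0 : R).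
Proof.
apply: (@squeeze_cvgr _ _ _ _ (cst 0) (fun N => 24 * Num.sqrt (harmonic N))).
- by near=> N; rewrite ratio_le // andbT divr_ge0.
- exact: cvg_cst.
- rewrite -[X in _ --> X](mulr0 24); apply: cvgMr.
  rewrite -[X in _ --> X]sqrtr0; apply: continuous_cvg cvg_harmonic.
  exact: sqrt_continuous.
Unshelve. all: by end_near.
Qed.
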